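(* Let $k\ge1$ and $\mathcal X\subset\mathbb R^n$ open. Any non-augmented MLP $\Phi\in\Xi^k(\mathcal X,\mathbb R)$ all of whose weight matrices have full rank has no critical point, i.e. $\nabla\Phi(x)\ne0$ for all $x\in\mathcal X$; that is, $\Xi^k_{\mathrm N,\mathbb W^*}(\mathcal X,\mathbb R)\subset(\mathcal C1)^k(\mathcal X,\mathbb R)$. Consequently, for every fixed non-augmented architecture (widths and activation functions), for all weights and biases $(\operatorname{vecm}(W);\operatorname{stk}(b))\in\mathbb R^{N_W+N_B}$, $W\in\mathbb W$, $b\in\mathbb B$, except possibly for a set of Lebesgue measure zero in $\mathbb R^{N_W+N_B}$, the corresponding non-augmented MLP $\Phi\in\Xi^k_{\mathrm N}(\mathcal X,\mathbb R)$ is of class $(\mathcal C1)^k(\mathcal X,\mathbb R)$ and hence (for $k\ge2$) a Morse function.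
   Context: MLP setting. An MLP with $L\ge1$ on an open set $\mathcal X\subset\mathbb R^n$ is given by $h_0=x\in\mathcal X$ and, for $l=1,\ldots,L$, $h_l=\widetilde W_l\,\sigma_l(a_l)+\tilde b_l$ with $a_l=W_lh_{l-1}+b_l$, where $W_l\in\mathbb R^{m_l\times n_{l-1}}$, $\widetilde W_l\in\mathbb R^{n_l\times m_l}$, $b_l\in\mathbb R^{m_l}$, $\tilde b_l\in\mathbb R^{n_l}$, all widths are $\ge1$, $n_0=n$, $n_L=1$, and $\sigma_l$ is applied component-wise with components $[\sigma_l]_i:\mathbb R\to\mathbb R$. The network map is $\Phi(x)=h_L\in\mathbb R$. $\Xi^k(\mathcal X,\mathbb R)$ is the set of all such MLPs with $[\sigma_l]_i$ strictly monotone and of class $C^k$ (strict monotonicity of a differentiable component means: its derivative is everywhere $>0$ or everywhere $<0$). Joint enumeration of widths and weight matrices: $d_{2l}=n_l$, $d_{2l-1}=m_l$, $V_{2l-1}=W_l$, $V_{2l}=\widetilde W_l$, so $V_j\in\mathbb R^{d_j\times d_{j-1}}$, $j=1,\ldots,2L$. The MLP is non-augmented if $d_{j-1}\ge d_j$ for all $j\in\{1,\ldots,2L\}$ (hence $d_j\le n$). $\Xi^k_{\mathrm N}$ denotes the set of non-augmented MLPs and $\Xi^k_{\mathrm N,\mathbb W^*}$ those with $W\in\mathbb W^*$. For fixed widths: $\mathbb W=\prod_{j=1}^{2L}\mathbb R^{d_j\times d_{j-1}}$ is the space of all weight tuples $W=(V_1,\ldots,V_{2L})$; $\mathbb W^*\subset\mathbb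 W$ is the set of tuples with $\operatorname{rank}(V_j)=\min\{d_j,d_{j-1}\}$ for all $j$; $\mathbb B=\prod_{j=1}^{2L}\mathbb R^{d_j}$ is the space of bias tuples $b=(b_1,\tilde b_1,\ldots,b_L,\tilde b_L)$. $\operatorname{vecm}:\mathbb W\to\mathbb R^{N_W}$, $N_W=\sum_j d_jd_{j-1}$, and $\operatorname{stk}:\mathbb B\to\mathbb R^{N_B}$, $N_B=\sum_{j=1}^{2L}d_j$, are the bijections stacking all entries into one vector. $(\mathcal C1)^k(\mathcal X,\mathbb R)$ is the set of $\Phi\in C^k(\mathcal X,\mathbb R)$ with $\nabla\Phi(x)\neq0$ for all $x\in\mathcal X$. A Morse function is a $C^2$ function all of whose critical points have non-singular Hessian. *)

(* Defs.v *)
From HB Require Import structures.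
From mathcomp Require Import all_boot all_order all_algebra.
From mathcomp Require Import all_classical all_reals all_analysis.
Import Order.TTheory GRing.Theory Num.Theory.
Import numFieldNormedType.Exports.

Set Implicit Arguments.
Unset Strict Implicit.
Unset Printing Implicit Defensive.

Local Open Scope classical_set_scope.
Local Open Scope ring_scope.

Section Differentiation.
Context {R : realType} {n : nat}.
Implicit Types (X : set 'cV[R]_n) (f : 'cV[R]_n -> R) (x : 'cV[R]_n).

Definition partial (i : 'I_n) f : 'cV[R]_n -> R :=
  fun x => 'D_(delta_mx i 0) f x.

Definition gradient f x : 'cV[R]_n := \col_i partial i f x.

Definition hessian f x : 'M[R]_n :=
  \matrix_(i, j) partial i (partial j f) x.

(* C^k on X, for X open: all iterated partial derivatives up to order k exist
   and are continuous at every point of X. Values outside X are irrelevant. *)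
Fixpoint class_C (k : nat) X f : Prop :=
  (forall x, X x -> {for x, continuous f}) /\
  if k is k'.+1 then
    forall i : 'I_n, (forall x, X x -> derivable f x (delta_mx i 0)) /\
                     class_C k' X (partial i f)
  else True.

Definition critical_point f x : Prop := gradient f x = 0.

(* The class (C1)^k(X, R). *)
Definition C1_class (k : nat) X : set ('cV[R]_n -> R) :=
  [set f | class_C k X f /\ forall x, X x -> ~ critical_point f x].

Definition morse X f : Prop :=
  class_C 2 X f /\
  forall x, X x -> critical_point f x -> hessian f x \in unitmx.

End Differentiation.

Section Activations.
Context {R : realType}.
Implicit Types s : R -> R.

Definition class_C_real (k : nat) s : Prop :=
  (forall j (t : R), (j < k)%N -> derivable (s^`(j))%classic t 1) /\
  (forall j, (j <= k)%N -> continuous (s^`(j))%classic).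

Definition strictly_monotone s : Prop :=
  (forall t, 0 < (s^`())%classic t) \/ (forall t, (s^`())%classic t < 0).

End Activations.

Definition box {R : realType} {N : nat} (lo hi : 'cV[R]_N) : set 'cV[R]_N :=
  [set x : 'cV[R]_N | forall i, lo i 0 <= x i 0 <= hi i 0].

(* Lebesgue-null subsets of R^N, N >= 1: sets that can be covered by countably
   many closed boxes of arbitrarily small total volume. (For N = 0 the empty
   product makes every box have volume 1.) *)
Definition lebesgue_null {R : realType} {N : nat} (A : set 'cV[R]_N) : Prop :=
  forall e : R, 0 < e ->
  exists lo hi : nat -> 'cV[R]_N,
    [/\ forall k i, lo k i 0 <= hi k i 0,
        A `<=` \bigcup_k box (lo k) (hi k) &
        (\sum_(0 <= k <oo) (\prod_i (hi k i 0 - lo k i 0))%:E <= e%:E)%E].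

(* Widths and activations. [width] is the joint enumeration d_0, ..., d_2L
   (values beyond 2L are unused): d_2l = n_l and d_(2l+1) = m_(l+1). Layers are
   numbered from 0, so that [act l i] is the i-th component of sigma_(l+1). *)
Record architecture (R : realType) (n : nat) := Architecture {
  depth : nat;
  width : nat -> nat;
  act : forall l : 'I_depth, 'I_(width l.*2.+1) -> R -> R;
  depth_gt0 : (0 < depth)%N;
  width_gt0 : forall j, (j <= depth.*2)%N -> (0 < width j)%N;
  width_in : width 0 = n;
  width_out : width depth.*2 = 1%N
}.

Section MLP.
Context {R : realType} {n : nat} (A : architecture R n).
Let L := depth A.
Let d := width A.

Definition weights := forall j : 'I_L.*2, 'M[R]_(d j.+1, d j).
Definition biases := forall j : 'I_L.*2, 'cV[R]_(d j.+1).

Fact inner_subproof (l : 'I_L) : (l.*2 < L.*2)%N.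
Proof. by rewrite ltn_double. Qed.

Fact outer_subproof (l : 'I_L) : (l.*2.+1 < L.*2)%N.
Proof. by rewrite ltn_Sdouble. Qed.

Definition inner (l : 'I_L) : 'I_L.*2 := Ordinal (inner_subproof l).
Definition outer (l : 'I_L) : 'I_L.*2 := Ordinal (outer_subproof l).

Section Evaluation.
Variables (W : weights) (b : biases).

Definition preactivation (l : 'I_L) (h : 'cV[R]_(d l.*2)) :
    'cV[R]_(d l.*2.+1) :=
  W (inner l) *m h + b (inner l).

Definition layer (l : 'I_L) (h : 'cV[R]_(d l.*2)) : 'cV[R]_(d l.*2.+2) :=
  W (outer l) *m (\col_i act i (preactivation h i 0)) + b (outer l).

Fixpoint hidden (h0 : 'cV[R]_(d 0)) (l : nat) : (l <= L)%N -> 'cV[R]_(d l.*2) :=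
  match l with
  | 0 => fun _ => h0
  | l'.+1 => fun lt_l'L => @layer (Ordinal lt_l'L) (hidden h0 (ltnW lt_l'L))
  end.

(* The casts only identify R^(d_0) with R^n and R^(d_2L) with R^1. *)
Definition mlp (x : 'cV[R]_n) : R :=
  castmx (width_out A, erefl 1%N)
    (hidden (castmx (esym (width_in A), erefl 1%N) x) (leqnn L)) 0 0.

End Evaluation.

Definition admissible (k : nat) : Prop :=
  forall (l : 'I_L) (i : 'I_(d l.*2.+1)),
    class_C_real k (act i) /\ strictly_monotone (act i).

Definition non_augmented : Prop :=
  forall j, (j < L.*2)%N -> (d j.+1 <= d j)%N.

Definition full_rank : set weights :=
  [set W | forall j : 'I_L.*2, \rank (W j) = minn (d j.+1) (d j)].

Definition N_W : nat := \sum_(j < L.*2) (d j.+1 * d j)%N.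
Definition N_B : nat := \sum_(j < L.*2) d j.+1.

Definition vecm (W : weights) : 'cV[R]_N_W := \mxcol_(j < L.*2) (mxvec (W j))^T.
Definition stk (b : biases) : 'cV[R]_N_B := \mxcol_(j < L.*2) b j.

End MLP.

Section Classes.
Context {R : realType} {n : nat}.
Implicit Types X : set 'cV[R]_n.

(* Maps on X are represented by total functions, of which only the values on X
   matter. *)
Definition Xi_N (k : nat) X : set ('cV[R]_n -> R) :=
  [set Phi | exists (A : architecture R n) (W : weights A) (b : biases A),
    [/\ admissible A k, non_augmented A & forall x, X x -> Phi x = mlp W b x]].

Definition Xi_N_Wstar (k : nat) X : set ('cV[R]_n -> R) :=
  [set Phi | exists (A : architecture R n) (W : weights A) (b : biases A),
    [/\ admissible A k, non_augmented A, full_rank W &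
        forall x, X x -> Phi x = mlp W b x]].

End Classes.

(* Main.v *)
(* At every point the Jacobian of the network is the product of the weight
   matrices and of invertible diagonal matrices holding the derivatives of the
   activations. When the widths do not increase and the weights have full rank,
   every factor has independent rows, hence so does the product, a single row:
   the gradient does not vanish.
   A weight matrix without full rank has a vanishing leading square minor. The
   zero set of a determinant in independent entries is null by induction on its
   size: the determinant is affine in its first entry, so that its zero set lies
   in the zero set of a smaller minor and countably many Lipschitz graphs. *)

Require Import Defs.
From HB Require Import structures.
From mathcomp Require Import all_boot all_order all_algebra.
From mathcomp Require Import all_classical all_reals all_analysis.
From mathcomp Require Import ring lra.
Import Order.TTheory GRing.Theory Num.Theory.
Import numFieldNormedType.Exports.

Set Implicit Arguments.
Unset Strict Implicit.
Unset Printing Implicit Defensive.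

Local Open Scope classical_set_scope.
Local Open Scope ring_scope.

(** * Functions of class C^k *)

Section DifferentiableClasses.
Context {R : realType} {n : nat}.
Implicit Types (X : set 'cV[R]_n) (f g : 'cV[R]_n -> R) (x v : 'cV[R]_n).

(* The derivative along v is the derivative at 0 of h |-> f (h *: v + x), so
   that this chain rule needs directional differentiability of f only. *)
Lemma is_derive_comp_dir (s : R -> R) f x v ds df :
  is_derive (f x) 1 s ds -> is_derive x v f df ->
  is_derive x v (s \o f) (ds * df).
Proof.
move=> s_f [f_xv f_df].
pose phi := fun h : R => f (h *: v + x).
have phi0 : phi 0 = f x by rewrite /phi scale0r add0r.
have deriv_line g : 'D_v g x = 'D_1 (fun h : R => g (h *: v + x)) 0.
  rewrite /derive; congr (lim (_ @ 0^')); rewrite funeqE => h /=.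
  by rewrite addr0 scale0r add0r [_%:A]mulr1.
have phi_is : is_derive (0 : R) 1 phi df.
  by apply: DeriveDef; [exact: (derivable1P f x v).1|rewrite -f_df deriv_line].
have comp_is : is_derive (0 : R) 1 (s \o phi) (ds * df).
  by apply: is_derive1_comp; rewrite phi0.
apply: DeriveDef; first by apply: (derivable1P (s \o f) x v).2; case: comp_is.
by rewrite deriv_line; case: comp_is.
Qed.

Lemma is_derive_coord (i : 'I_n) x v :
  is_derive x v (fun y : 'cV[R]_n => y i 0 : R) (v i 0 : R).
Proof.
have quot : (fun h : R => h^-1 *: ((h *: v + x) i 0 - x i 0)) @ 0^'
    --> v i 0.
  apply: cvg_near_cst.
  near=> h; rewrite !mxE addrK; apply: mulKf.
  by near: h; exact: nbhs_dnbhs_neq.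
by split; [apply/cvg_ex; exists (v i 0)|exact: cvg_lim quot].
Unshelve. all: by end_near. Qed.

Lemma class_C_continuous k X f x : class_C k X f -> X x -> {for x, continuous f}.
Proof. by case: k => [|k] [+ _]; apply. Qed.

Lemma near_eq_open X f g x : open X -> (forall y, X y -> f y = g y) -> X x ->
  \forall y \near x, f y = g y.
Proof.
move=> oX fg Xx; have : nbhs x X by exact: open_nbhs_nbhs.
by apply: filterS.
Qed.

Lemma eq_continuous_open X f g : open X -> (forall x, X x -> f x = g x) ->
  (forall x, X x -> {for x, continuous f}) ->
  forall x, X x -> {for x, continuous g}.
Proof.
move=> oX fg fX x Xx; have := fX x Xx.
rewrite /prop_for /continuous_at -(fg _ Xx); apply: cvg_trans.
exact: (@near_eq_cvg _ _ (nbhs x) _ f g (near_eq_open oX fg Xx)).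
Qed.

(** Openness turns equality on [X] into equality near each of its points, which is all that partial
    derivatives see. The differentiation rules below give identities on [X] only, and this lemma
    transfers the class along them. *)
Lemma eq_class_C k X f g : open X -> (forall x, X x -> f x = g x) ->
  class_C k X f -> class_C k X g.
Proof.
move=> oX; elim: k f g => [|k IH] f g fg [fX df]; split=> //;
  try exact: eq_continuous_open fX.
move=> i; have [dfi dfC] := df i; split=> [x Xx|].
  exact: near_eq_derivable (near_eq_open oX fg Xx) (dfi x Xx).
by apply: IH dfC => x Xx; apply: near_eq_derive (near_eq_open oX fg Xx).
Qed.

Lemma class_C_pred k X f : class_C k.+1 X f -> class_C k X f.
Proof.
elim: k f => [|k IH] f [fX df]; split=> // i; have [dfi dfC] := df i.
by split=> //; exact: IH.
Qed.

Lemma class_C_leq m k X f : (m <= k)%N -> class_C k X f -> class_C m X f.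
Proof.
move=> /subnK <-; elim: (k - m)%N => // d IH.
by rewrite addSn => /class_C_pred.
Qed.

Lemma class_C_cst k X a : class_C k X (cst a).
Proof.
elim: k a => [|k IH] a; split=> //; try by move=> x _; exact: cst_continuous.
move=> i; split=> [x _|]; first exact: derivable_cst.
suff -> : partial i (cst a) = cst (0 : R) :> ('cV[R]_n -> R) by exact: IH.
by apply/funext => x; rewrite /partial derive_cst.
Qed.

Lemma class_C_coord k X (j : 'I_n) : class_C k X (fun x => x j 0).
Proof.
case: k => [|k]; split=> //; try by move=> x _; exact: coord_continuous.
move=> i; split=> [x _|]; first by have [] := is_derive_coord j x (delta_mx i 0).
suff -> : partial i (fun x => x j 0) = cst (delta_mx i (0 : 'I_1) j 0 : R).
  exact: class_C_cst.
by apply/funext => x; have [] := is_derive_coord j x (delta_mx i 0).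
Qed.

(** * Closure of C^k under sums, products and composition on an open domain *)

Section OpenDomain.
Variables (X : set 'cV[R]_n) (oX : open X).

Lemma class_CD k f g : class_C k X f -> class_C k X g ->
  class_C k X (fun x => f x + g x).
Proof.
elim: k f g => [|k IH] f g [fX df] [gX dg].
  by split=> // x Xx; exact: cvgD (fX x Xx) (gX x Xx).
split=> [x Xx|i]; first exact: cvgD (fX x Xx) (gX x Xx).
have [dfi dfC] := df i; have [dgi dgC] := dg i.
split=> [x Xx|]; first by apply: derivableD; [exact: dfi|exact: dgi].
apply: (eq_class_C oX _ (IH _ _ dfC dgC)) => x Xx.
by apply/esym; apply: deriveD; [exact: dfi|exact: dgi].
Qed.

Lemma class_C_sum k (I : Type) (r : seq I) (F : I -> 'cV[R]_n -> R) :
  (forall i, class_C k X (F i)) -> class_C k X (fun x => \sum_(i <- r) F i x).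
Proof.
move=> FC; elim: r => [|i r IH].
  rewrite (_ : (fun=> _) = cst 0); first exact: class_C_cst.
  by apply/funext => x; rewrite big_nil.
rewrite (_ : (fun=> _) = fun x => F i x + \sum_(j <- r) F j x).
  exact: class_CD.
by apply/funext => x; rewrite big_cons.
Qed.

Lemma class_CM k f g : class_C k X f -> class_C k X g ->
  class_C k X (fun x => f x * g x).
Proof.
elim: k f g => [|k IH] f g fC gC; have [fX df] := fC; have [gX dg] := gC.
  by split=> // x Xx; exact: cvgM (fX x Xx) (gX x Xx).
split=> [x Xx|i]; first exact: cvgM (fX x Xx) (gX x Xx).
have [dfi dfC] := df i; have [dgi dgC] := dg i.
split=> [x Xx|]; first by apply: derivableM; [exact: dfi|exact: dgi].
(* Leibniz rule: in [f * partial i g + g * partial i f] the undifferentiated factors are lowered to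
   class [k], so that the induction hypothesis covers both products. *)
have := class_CD (IH _ _ (class_C_pred fC) dgC) (IH _ _ (class_C_pred gC) dfC).
apply: eq_class_C oX _ => x Xx.
by apply/esym; apply: deriveM; [exact: dfi|exact: dgi].
Qed.

(** Induction on [k]: a partial derivative of [s \o f] is the product of [s' \o f] and a partial
    derivative of [f], where [s'] has lost one order of smoothness. *)
Lemma class_C_comp k (s : R -> R) f : class_C_real k s -> class_C k X f ->
  class_C k X (s \o f).
Proof.
elim: k s f => [|k IH] s f [ds cs] fC.
  split=> // x Xx; apply: continuous_comp; first exact: class_C_continuous fC Xx.
  exact: (cs 0%N).
split=> [x Xx|i].
  apply: continuous_comp; first exact: class_C_continuous fC Xx.
  exact: (cs 0%N).
have [_ /(_ i)[dfi dfC]] := fC.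
have sf x : X x ->
    is_derive x (delta_mx i 0) (s \o f) (s^`()%classic (f x) * partial i f x).
  move=> Xx; apply: is_derive_comp_dir; last exact/derivableP/dfi.
  by rewrite derive1E; apply/derivableP/(ds 0%N).
split=> [x /sf[]//|].
have s'C : class_C_real k s^`()%classic.
  split=> [j t jk|j jk]; rewrite -derive1Sn; [exact: ds|exact: cs].
apply: (eq_class_C oX _ (class_CM (IH _ _ s'C (class_C_pred fC)) dfC)) => x Xx.
by rewrite [RHS]/partial; have [_ ->] := sf x Xx.
Qed.

End OpenDomain.
End DifferentiableClasses.

(** * The Jacobian of the network *)

Lemma row_free_mul (F : fieldType) m n p (A : 'M[F]_(m, n)) (B : 'M[F]_(n, p)) :
  row_free A -> row_free B -> row_free (A *m B).
Proof. by rewrite /row_free => ? ?; rewrite mxrankMfree. Qed.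

Lemma row_free_diag (F : fieldType) m (c : 'rV[F]_m) :
  (forall i, c 0 i != 0) -> row_free (diag_mx c).
Proof.
move=> c0; rewrite row_free_unit unitmxE det_diag unitfE.
by apply/prodf_neq0 => i _.
Qed.

Lemma castmx_colE (T : Type) m p (e : m = p) (x : 'cV[T]_m) i :
  castmx (e, erefl 1%N) x i 0 = x (cast_ord (esym e) i) 0.
Proof. by rewrite castmxE cast_ord_id. Qed.

Section Layers.
Context {R : realType} {n : nat}.
Implicit Types (X : set 'cV[R]_n).

Lemma class_C_affine k X m p (M : 'M[R]_(p, m)) (c : 'cV[R]_p)
    (h : 'cV[R]_n -> 'cV[R]_m) : open X ->
  (forall i, class_C k X (fun x => h x i 0)) ->
  forall i, class_C k X (fun x => (M *m h x + c) i 0).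
Proof.
move=> oX hC i.
rewrite (_ : (fun=> _) = fun x => \sum_j (cst (M i j) x * h x j 0) + cst (c i 0) x).
  apply: class_CD => //; last exact: class_C_cst.
  by apply: class_C_sum => // j; apply: class_CM => //; exact: class_C_cst.
by apply/funext => x; rewrite !mxE.
Qed.

Lemma is_derive_affine m p (M : 'M[R]_(p, m)) (c : 'cV[R]_p)
    (h : 'cV[R]_n -> 'cV[R]_m) (x v : 'cV[R]_n) (dh : 'cV[R]_m) :
  (forall i, is_derive x v (fun y => h y i 0 : R) (dh i 0 : R)) ->
  forall i, is_derive x v (fun y => (M *m h y + c) i 0 : R) ((M *m dh) i 0 : R).
Proof.
move=> hdh i.
rewrite (_ : (fun y => _) =
    (\sum_j (M i j \*: (fun y => h y j 0 : R))) + cst (c i 0)); last first.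
  apply/funext => y; rewrite !mxE; congr +%R.
  by rewrite fct_sumE.
rewrite mxE -[X in is_derive _ _ _ X]addr0.
apply: is_deriveD; apply: is_derive_sum => j; exact: is_deriveZ.
Qed.

End Layers.

Section Network.
Context {R : realType} {n : nat} (A : architecture R n) (k : nat).
Hypothesis A_adm : admissible A k.
Variables (W : weights A) (b : biases A).

Lemma class_C_mlp (X : set 'cV[R]_n) : open X -> class_C k X (mlp W b).
Proof.
move=> oX.
suff hC l (lL : (l <= depth A)%N) i : class_C k X (fun x =>
    hidden W b (castmx (esym (width_in A), erefl 1%N) x) lL i 0).
  rewrite (_ : mlp W b = fun x =>
    hidden W b (castmx (esym (width_in A), erefl 1%N) x) (leqnn _)
      (cast_ord (esym (width_out A)) 0) 0) //.
  by apply/funext => x; rewrite /mlp castmx_colE.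
elim: l lL i => [|l IH] lL i.
  rewrite (_ : (fun=> _) = fun x : 'cV[R]_n => x (cast_ord (esym (esym (width_in A))) i) 0).
    exact: class_C_coord.
  by apply/funext => x; rewrite /= castmx_colE.
apply: class_C_affine => // j; rewrite /=.
pose f x := preactivation W b (l := Ordinal lL)
  (hidden W b (castmx (esym (width_in A), erefl 1%N) x) (ltnW lL)) j 0.
rewrite (_ : (fun=> _) = act j \o f); last by apply/funext => x; rewrite mxE.
apply: class_C_comp => //; first by have [] := A_adm j.
exact: class_C_affine.
Qed.

Hypotheses (k_gt0 : (0 < k)%N) (A_nonaug : non_augmented A).
Hypothesis W_full : full_rank W.

Lemma row_free_weight (j : 'I_(depth A).*2) : row_free (W j).
Proof. by rewrite /row_free W_full (minn_idPl _)// A_nonaug. Qed.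

Lemma act_derive_neq0 (l : 'I_(depth A)) (i : 'I_(width A l.*2.+1)) (t : R) :
  (act i)^`()%classic t != 0.
Proof.
by have [_ [s_gt0|s_lt0]] := A_adm i; [rewrite gt_eqF|rewrite lt_eqF].
Qed.

Lemma is_derive_act (l : 'I_(depth A)) (i : 'I_(width A l.*2.+1)) (t : R) :
  is_derive t 1 (act i) ((act i)^`()%classic t).
Proof.
by have [[ds _] _] := A_adm i; rewrite derive1E; apply/derivableP/(ds 0%N).
Qed.

(** Directional derivatives along every [v] characterise the Jacobian [M] without Fréchet
    differentiability. Row-freeness goes through the induction with them, since a layer multiplies
    [M] on the left by row-free matrices. *)
Lemma hidden_jacobian x l (lL : (l <= depth A)%N) :
  exists2 M : 'M[R]_(width A l.*2, n), row_free M &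
    forall v i, is_derive x v (fun y =>
      hidden W b (castmx (esym (width_in A), erefl 1%N) y) lL i 0 : R)
      ((M *m v) i 0 : R).
Proof.
elim: l lL => [|l IH] lL.
  exists (castmx (esym (width_in A), erefl n) 1%:M).
    (* Eliminating the equality of dimensions turns the cast into the identity. *)
    by case: _ / (esym _); rewrite castmx_id row_free_unit unitmx1.
  move=> v i; rewrite (_ : (fun y => _) = fun y : 'cV[R]_n =>
      y (cast_ord (esym (esym (width_in A))) i) 0 : R); last first.
    by apply/funext => y; rewrite /= castmx_colE.
  suff -> : castmx (esym (width_in A), erefl n) 1%:M *m v =
            castmx (esym (width_in A), erefl 1%N) v.
    by rewrite castmx_colE; exact: is_derive_coord.
  by case: _ / (esym _); rewrite !castmx_id mul1mx.
have [M M_free dM] := IH (ltnW lL).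
pose l' := Ordinal lL.
pose f y := preactivation W b (l := l')
  (hidden W b (castmx (esym (width_in A), erefl 1%N) y) (ltnW lL)).
(* Slopes of the activations at the preactivations of the base point [x]: the diagonal factor of the
   chain rule. *)
pose D := \row_i (act i)^`()%classic (f x i 0).
exists (W (outer l') *m (diag_mx D *m (W (inner l') *m M))).
  apply: row_free_mul; first exact: (row_free_weight (outer l')).

  apply: row_free_mul; last exact: row_free_mul (row_free_weight (inner l')) M_free.
  by apply: row_free_diag => i; rewrite mxE act_derive_neq0.
move=> v i; rewrite -!mulmxA; apply: is_derive_affine => j.
rewrite mul_diag_mx mxE [D _ _]mxE.
rewrite (_ : (fun y => _) = act j \o (fun y => f y j 0 : R)); last first.
  by apply/funext => y; rewrite mxE.
apply: is_derive_comp_dir; first exact: is_derive_act.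
exact: (is_derive_affine (W (inner l')) (b (inner l'))).
Qed.

(** At the output layer the Jacobian is a single row, whose entries are the partial derivatives. A
    zero gradient would make this row zero, of rank 0 instead of 1. *)
Lemma gradient_mlp_neq0 x : gradient (mlp W b) x <> 0.
Proof.
have [M M_free dM] := hidden_jacobian x (leqnn (depth A)).
move=> grad0; suff M0 : M = 0.
  by move: M_free; rewrite M0 /row_free mxrank0 width_out.
apply/matrixP => i j; rewrite [RHS]mxE.
have -> : M i j = (M *m (delta_mx j 0 : 'cV_n)) i 0 by rewrite -colE mxE.
have [_ <-] := dM (delta_mx j 0) i.
have := congr1 (fun c : 'cV[R]_n => c j 0) grad0; rewrite !mxE => <-.
rewrite /partial; congr ('D_ _ _ _); apply/funext => y.
rewrite /mlp castmx_colE; congr (hidden _ _ _ _ _ 0).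
by apply: (can_inj (cast_ordK (width_out A))); rewrite !ord1.
Qed.

End Network.

(** * Null sets *)

Section NullSets.
Context {R : realType} {N : nat}.
Implicit Types (A B : set 'cV[R]_N) (p : 'cV[R]_N).

Definition volume (lo hi : 'cV[R]_N) : R := \prod_i (hi i 0 - lo i 0).

Lemma volume_ge0 (lo hi : 'cV[R]_N) :
  (forall i, lo i 0 <= hi i 0) -> 0 <= volume lo hi.
Proof. by move=> lohi; apply: prodr_ge0 => i _; rewrite subr_ge0. Qed.

Lemma lebesgue_null_subset A B : A `<=` B -> lebesgue_null B -> lebesgue_null A.
Proof.
move=> AB Bnull e /Bnull[lo [hi [lohi Bcov vol]]].
by exists lo, hi; split=> //; exact: subset_trans AB Bcov.
Qed.

Hypothesis N_gt0 : (0 < N)%N.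

(** Boxes may be indexed by any countable type, such as pairs or grid cells; [pickle] arranges them
    in a sequence. *)
Lemma lebesgue_null_countable_cover A :
  (forall e : R, 0 < e -> exists (I : countType) (lo hi : I -> 'cV[R]_N),
    [/\ forall t i, lo t i 0 <= hi t i 0,
        A `<=` \bigcup_t box (lo t) (hi t) &
        (\esum_(t in [set: I]) (volume (lo t) (hi t))%:E <= e%:E)%E]) ->
  lebesgue_null A.
Proof.
move=> Acov e /Acov[I [lo [hi [lohi covA vole]]]].
(* Codes of no index get the default 0 as both corners: a degenerate box, of volume 0 because [N] is
   positive. *)
pose seqof (f : I -> 'cV[R]_N) (k : nat) := if pickle_inv k is Some t then f t else 0.
have seqofK f t : seqof f (pickle t) = f t by rewrite /seqof pickleK_inv.
have lohi' k i : seqof lo k i 0 <= seqof hi k i 0.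
  by rewrite /seqof; case: pickle_inv => // t; exact: lohi.
exists (seqof lo), (seqof hi); split=> //.
  by move=> p /covA[t _ pt]; exists (pickle t); rewrite // !seqofK.
rewrite nneseries_esumT; last by move=> k; rewrite lee_fin volume_ge0.
rewrite -[leLHS](_ : (\esum_(k in range (@pickle I))
    (volume (seqof lo k) (seqof hi k))%:E)%E = _).
  rewrite esum_image; last by move=> t u _ _; exact: (pcan_inj pickleK_inv).
  by apply: le_trans vole; apply: le_esum => t _; rewrite !seqofK.
rewrite esum_mkcond; apply: eq_esum => k _; case: ifPn => //.
rewrite notin_setE /= /seqof; case k_inv: (pickle_inv k) => [t|] nk.
  by case: nk; exists t => //; have := @pickle_invK I k; rewrite k_inv.
by rewrite (bigD1 (Ordinal N_gt0))//= !mxE subrr mul0r.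
Qed.

Lemma lebesgue_null0 : lebesgue_null (set0 : set 'cV[R]_N).
Proof.
apply: lebesgue_null_countable_cover => e e_gt0.
exists void, (fun _ => 0), (fun _ => 0); split=> //.
by rewrite esum1 ?lee_fin ?ltW.
Qed.

Lemma lebesgue_null_bigcup (I : countType) (F : I -> set 'cV[R]_N) :
  (forall i, lebesgue_null (F i)) -> lebesgue_null (\bigcup_i F i).
Proof.
move=> Fnull; apply: lebesgue_null_countable_cover => e e_gt0.
(* The set with code [k] may use volume [e / 2 ^ k.+1]; the codes that occur form a subset of the
   naturals, so the total is at most [e]. *)
have eps_gt0 (i : I) : 0 < e / (2 ^ (pickle i).+1)%:R.
  by rewrite divr_gt0// ltr0n expn_gt0.
have [c cP] := choice (fun i => Fnull i _ (eps_gt0 i)).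
have [d dP] := choice cP.
exists (I * nat)%type, (fun t => c t.1 t.2), (fun t => d t.1 t.2).
split=> [[i k] j|p [i _ Fp]|]; first by have [] := dP i.
  by have [_ /(_ p Fp)[k _ pk] _] := dP i; exists (i, k).
have vol_ge0 i k : (0 <= (volume (c i k) (d i k))%:E)%E.
  by rewrite lee_fin volume_ge0// => j; have [] := dP i.
rewrite (_ : [set: I * nat] = [set: I] `*`` (fun=> [set: nat])); last first.
  by apply/seteqP; split.
rewrite -(@esum_esum _ _ _ _ _ (fun i k => (volume (c i k) (d i k))%:E))//.
apply: (@le_trans _ _ (\esum_(i in [set: I])
    (e / (2 ^ (pickle i).+1)%:R)%:E)%E).
  apply: le_esum => i _; rewrite -nneseries_esumT//.
  by have [] := dP i.
rewrite -(esum_image _ (@pickle I) (fun k => (e / (2 ^ k.+1)%:R)%:E)); last first.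
  by move=> t u _ _; exact: (pcan_inj pickleK_inv).
apply: (le_trans _ (epsilon_trick0 xpredT (ltW e_gt0))).
have ge0 k : (0 <= (e / (2 ^ k.+1)%:R)%:E)%E.
  by rewrite lee_fin divr_ge0 ?ler0n ?ltW.
rewrite nneseries_esumT// esum_mkcond; apply: le_esum => k _.
by case: ifP.
Qed.

Lemma lebesgue_nullU A B :
  lebesgue_null A -> lebesgue_null B -> lebesgue_null (A `|` B).
Proof.
move=> Anull Bnull.
apply: (@lebesgue_null_subset _ (\bigcup_(b : bool) if b then A else B)).
  by move=> p [Ap|Bp]; [exists true|exists false].
by apply: lebesgue_null_bigcup => -[].
Qed.

(** * Covering bounded Lipschitz graphs by grids *)

Lemma esum_finType (T : finType) (f : T -> \bar R) : (forall t, (0 <= f t)%E) ->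
  (\esum_(t in [set: T]) f t = \sum_t f t)%E.
Proof.
move=> f_ge0; have -> : [set: T] = [set` index_enum T].
  by apply/seteqP; split=> t //= _; exact: mem_index_enum.
rewrite esum_fset; [|exact: finite_seq|by move=> t _; exact: f_ge0].
by rewrite -fsbig_seq ?index_enum_uniq.
Qed.

Lemma grid_cell (h : R) n (y : R) : 0 <= y <= h * n.+1%:R ->
  exists c : 'I_n.+1, h * c%:R <= y <= h * c.+1%:R.
Proof.
elim: n => [|n IH] /andP[y0 yn].
  by exists ord0; rewrite mulr0 y0.
have [yle|/ltW yge] := leP y (h * n.+1%:R); last by exists ord_max; rewrite yge.
by have [|c cP] := IH; [rewrite y0|exists (widen_ord (leqnSn _) c)].
Qed.

(* Split the base of the cube |p j| <= q into K ^ (N - 1) cells of side 2q / K;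
   over each cell, A lies in a slab of height O(1 / K). *)
Lemma lebesgue_null_lipschitz_graph A (i0 : 'I_N) (q C : R) : 0 < q -> 0 <= C ->
  (forall p, A p -> forall j, `|p j 0| <= q) ->
  (forall p p' delta, A p -> A p' -> 0 <= delta ->
    (forall j, j != i0 -> `|p j 0 - p' j 0| <= delta) ->
    `|p i0 0 - p' i0 0| <= C * delta) ->
  lebesgue_null A.
Proof.
move=> q_gt0 C_ge0 Aq AC; apply: lebesgue_null_countable_cover => e e_gt0.
pose base := \prod_(j : 'I_N | j != i0) (2 * q).
have base_ge0 : 0 <= base by apply: prodr_ge0 => j _; rewrite mulr_ge0 ?ltW.
(* With K = [m.+1] the slabs have total volume [2 * C * (2 * q) * base / m.+1], which this choice
   brings below [e]. *)
pose m := Num.truncn (2 * C * (2 * q) * base / e).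
have m_large : 2 * C * (2 * q) * base / e < m.+1%:R by exact: truncnS_gt.
pose h := 2 * q / m.+1%:R.
have h_gt0 : 0 < h by rewrite divr_gt0 ?mulr_gt0.
have hm : h * m.+1%:R = 2 * q by rewrite divfK.
pose cell (t : {ffun 'I_N -> 'I_m.+1}) : set 'cV[R]_N :=
  [set p | A p /\ forall j, j != i0 -> h * (t j)%:R <= p j 0 + q <= h * (t j).+1%:R].
(* A reference point of [A] over the cell, at which the slab is centred. Over an empty cell the
   default 0 is harmless: the volume of the slab does not depend on its centre. *)
pose pt t := xget 0 (cell t).
(* The index [t] also has a component at [i0], so that the sum of volumes factors over all
   coordinates. Only [t i0 = ord0] gives a slab of positive height, so each base cell counts
   once. *)
pose half c : R := if c == ord0 :> 'I_m.+1 then C * h else 0.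
have half_ge0 c : 0 <= half c.
  by rewrite /half; case: ifP => // _; exact: mulr_ge0 C_ge0 (ltW h_gt0).
pose lo t : 'cV[R]_N :=
  \col_j if j == i0 then pt t i0 0 - half (t i0) else h * (t j)%:R - q.
pose hi t : 'cV[R]_N :=
  \col_j if j == i0 then pt t i0 0 + half (t i0) else h * (t j).+1%:R - q.
pose side j (c : 'I_m.+1) : R := if j == i0 then half c *+ 2 else h.
have sideE t j : hi t j 0 - lo t j 0 = side j (t j).
  rewrite !mxE /side; case: eqP => [->|_]; first by ring.
  by rewrite -natr1; ring.
exists {ffun 'I_N -> 'I_m.+1}, lo, hi; split=> [t j|p Ap|].
- rewrite -subr_ge0 sideE /side; case: ifP => _; last exact: ltW.
  by rewrite mulrn_wge0.
- have /choice[t0 t0P] (j : 'I_N) : exists c : 'I_m.+1,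
      h * c%:R <= p j 0 + q <= h * c.+1%:R.
    apply: grid_cell; rewrite hm mulr_natl mulr2n lerD2r -lerBlDr sub0r -ler_norml.
    exact: Aq.
  pose t := [ffun j => if j == i0 then ord0 else t0 j].
  have cell_p : cell t p.
    by split=> // j /negPf ji0; rewrite ffunE ji0; exact: t0P.
  have [Ar cell_r] : cell t (pt t) by exact: xgetI cell_p.
  exists t => // j; rewrite !mxE; case: ifPn => [/eqP->|ji0].
    (* Two points over one cell differ by at most [h] in each base coordinate, hence by at most
       [C * h] in coordinate [i0]. *)
    rewrite -ler_distl ffunE eqxx /half eqxx; apply: AC => //; first exact: ltW.
    move=> i ii0; have [_ /(_ i ii0)] := cell_p; have := cell_r i ii0.
    rewrite -natr1 mulrDr mulr1 ler_norml.
    move=> /andP[r1 r2] /andP[p1 p2]; apply/andP; split.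
      by lra.
    by lra.
  by have [_ /(_ j ji0)] := cell_p; rewrite lerBlDr lerBrDr.
rewrite esum_finType; last first.
  move=> t; rewrite lee_fin volume_ge0// => j; rewrite -subr_ge0 sideE /side.
  by case: ifP => _; [rewrite mulrn_wge0|exact: ltW].
rewrite sumEFin lee_fin /volume.
under eq_bigr => t _ do under eq_bigr => j _ do rewrite sideE.
have side_i0 : \sum_c side i0 c = C * h *+ 2.
  rewrite (bigD1 ord0)//= big1 => [|c c0]; first by rewrite addr0 /side /half !eqxx.
  by rewrite /side eqxx /half (negPf c0) mul0rn.
have side_base j : j != i0 -> \sum_c side j c = 2 * q.
  move=> ji0; rewrite /side (negPf ji0) sumr_const card_ord -hm.
  by rewrite mulr_natr.
(* Distributivity: the sum over all [t] of products of sides is the product over the coordinates of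
   the sums of sides. *)
rewrite -(bigA_distr_bigA side) (bigD1 i0)//= side_i0 (eq_bigr _ side_base) -/base.
have -> : (C * h) *+ 2 * base = 2 * C * (2 * q) * base / m.+1%:R.
  by rewrite /h; ring.
by rewrite ler_pdivrMr// -ler_pdivrMl// mulrC; exact: ltW.
Qed.

(* f is Lipschitz on every cube and does not depend on coordinate i0. *)
Definition lipschitz_off (i0 : 'I_N) (f : 'cV[R]_N -> R) : Prop :=
  forall q : R, exists2 C : R, 0 <= C & forall p p' delta,
    (forall j, `|p j 0| <= q) -> (forall j, `|p' j 0| <= q) -> 0 <= delta ->
    (forall j, j != i0 -> `|p j 0 - p' j 0| <= delta) ->
    `|f p - f p'| <= C * delta.

(** * Algebra of functions Lipschitz on cubes, and zero sets of affine equations *)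

Section LipschitzOff.
Variable i0 : 'I_N.

(** Comparison with the value at the origin, at distance at most [q]. Taking [|q|] in the bound
    keeps it nonnegative for every [q]. Products need this bound. *)
Lemma lipschitz_off_bounded f q : lipschitz_off i0 f ->
  exists2 B : R, 0 <= B & forall p, (forall j, `|p j 0| <= q) -> `|f p| <= B.
Proof.
move=> /(_ q)[C C_ge0 fC]; exists (`|f 0| + C * `|q|).
  by rewrite addr_ge0// mulr_ge0.
move=> p pq; rewrite -lerBlDl (le_trans (lerB_dist _ _))//.
have q_ge0 : 0 <= q by exact: le_trans (normr_ge0 _) (pq i0).
apply: fC => // j; first by rewrite mxE normr0.
by move=> _; rewrite mxE subr0 (ger0_norm q_ge0).
Qed.

Lemma lipschitz_off_cst c : lipschitz_off i0 (fun=> c).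
Proof. by move=> q; exists 0 => // *; rewrite subrr normr0 mul0r. Qed.

Lemma lipschitz_off_coord j : j != i0 -> lipschitz_off i0 (fun p => p j 0).
Proof. by move=> ji0 q; exists 1 => // p p' d _ _ _ /(_ j ji0); rewrite mul1r. Qed.

Lemma lipschitz_offD f g : lipschitz_off i0 f -> lipschitz_off i0 g ->
  lipschitz_off i0 (fun p => f p + g p).
Proof.
move=> fL gL q; have [C C_ge0 fC] := fL q; have [D D_ge0 gD] := gL q.
exists (C + D) => [|p p' d pq p'q d_ge0 pp']; first exact: addr_ge0.
rewrite opprD addrACA mulrDl (le_trans (ler_normD _ _))// lerD//.
  exact: fC.
exact: gD.
Qed.

Lemma lipschitz_offM f g : lipschitz_off i0 f -> lipschitz_off i0 g ->
  lipschitz_off i0 (fun p => f p * g p).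
Proof.
move=> fL gL q; have [C C_ge0 fC] := fL q; have [D D_ge0 gD] := gL q.
have [Bf Bf_ge0 fB] := lipschitz_off_bounded q fL.
have [Bg Bg_ge0 gB] := lipschitz_off_bounded q gL.
exists (Bf * D + C * Bg) => [|p p' d pq p'q d_ge0 pp'].
  by rewrite addr_ge0 ?mulr_ge0.
have -> : f p * g p - f p' * g p' = f p * (g p - g p') + (f p - f p') * g p'.
  by ring.
rewrite (le_trans (ler_normD _ _))// !normrM mulrDl -mulrA mulrAC lerD//.
  by rewrite ler_pM//; [exact: fB|exact: gD].
by rewrite ler_pM//; [exact: fC|exact: gB].
Qed.

Lemma lipschitz_off_sum (I : Type) (r : seq I) (F : I -> 'cV[R]_N -> R) :
  (forall i, lipschitz_off i0 (F i)) ->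
  lipschitz_off i0 (fun p => \sum_(i <- r) F i p).
Proof.
move=> FL; elim: r => [|i r IH].
  by under eq_fun do rewrite big_nil; exact: lipschitz_off_cst.
by under eq_fun do rewrite big_cons; exact: lipschitz_offD.
Qed.

Lemma lipschitz_off_prod (I : Type) (r : seq I) (F : I -> 'cV[R]_N -> R) :
  (forall i, lipschitz_off i0 (F i)) ->
  lipschitz_off i0 (fun p => \prod_(i <- r) F i p).
Proof.
move=> FL; elim: r => [|i r IH].
  by under eq_fun do rewrite big_nil; exact: lipschitz_off_cst.
by under eq_fun do rewrite big_cons; exact: lipschitz_offM.
Qed.

Lemma lipschitz_off_det m (V : 'cV[R]_N -> 'M[R]_m) :
  (forall r c, lipschitz_off i0 (fun p => V p r c)) ->
  lipschitz_off i0 (fun p => \det (V p)).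
Proof.
move=> VL; apply: lipschitz_off_sum => s; apply: lipschitz_offM.
  exact: lipschitz_off_cst.
by apply: lipschitz_off_prod => r; exact: VL.
Qed.

(** Where [a] is nonzero the equation reads [p i0 0 = - b p / a p], a graph over the other
    coordinates. It is Lipschitz on each of the countably many pieces [Z m], where [p] is bounded
    and [a] stays away from 0. *)
Lemma lebesgue_null_affine_zero (a b : 'cV[R]_N -> R) :
  lipschitz_off i0 a -> lipschitz_off i0 b ->
  lebesgue_null [set p | a p != 0 /\ a p * p i0 0 + b p = 0].
Proof.
move=> aL bL.
pose Z (m : nat) := [set p : 'cV[R]_N | [/\ forall j, `|p j 0| <= m.+1%:R,
  1 <= m.+1%:R * `|a p| & a p * p i0 0 + b p = 0]].
apply: (@lebesgue_null_subset _ (\bigcup_m Z m)).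
  move=> p [a_neq0 p0].
  pose m := Num.truncn (\sum_j `|p j 0| + `|a p|^-1).
  have m_gt : \sum_j `|p j 0| + `|a p|^-1 < m.+1%:R by exact: truncnS_gt.
  have sum_ge0 : 0 <= \sum_j `|p j 0| by apply: sumr_ge0.
  exists m => //; split=> // [j|].
    rewrite (le_trans _ (ltW m_gt))// (bigD1 j)//= -addrA lerDl addr_ge0//.
    exact: sumr_ge0.
  rewrite -ler_pdivrMr ?normr_gt0// mul1r (le_trans _ (ltW m_gt))//.
  by rewrite lerDr.
apply: lebesgue_null_bigcup => m; set q : R := m.+1%:R.
have q_gt0 : 0 < q by rewrite ltr0n.
have [Ca Ca_ge0 aC] := aL q; have [Cb Cb_ge0 bC] := bL q.
(* The Lipschitz constant of the graph: subtracting the two equations bounds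
   [|a p| * |p i0 0 - p' i0 0|] by [(Cb + Ca * q) * d], and [1 <= q * |a p|] removes the factor
   [|a p|]. *)
have C_ge0 : 0 <= q * (Cb + Ca * q).
  by rewrite mulr_ge0 ?addr_ge0 ?mulr_ge0// ltW.
apply: (lebesgue_null_lipschitz_graph (i0 := i0) q_gt0 C_ge0) => [p []//|].
move=> p p' d [pq ap p0] [p'q ap' p'0] d_ge0 pp'.
have diff : a p * (p i0 0 - p' i0 0) = (b p' - b p) + (a p' - a p) * p' i0 0.
  have -> : b p = - (a p * p i0 0) by apply/eqP; rewrite -addr_eq0 addrC p0.
  have -> : b p' = - (a p' * p' i0 0) by apply/eqP; rewrite -addr_eq0 addrC p'0.
  by ring.
have bound : `|a p| * `|p i0 0 - p' i0 0| <= (Cb + Ca * q) * d.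
  rewrite -normrM diff (le_trans (ler_normD _ _))// [leRHS]mulrDl lerD//.
    by rewrite distrC; exact: bC.
  rewrite normrM mulrAC ler_pM//.
  by rewrite distrC; exact: aC.
rewrite -mulrA; apply: le_trans (ler_wpM2l (ltW q_gt0) bound).
by rewrite mulrA ler_peMl.
Qed.

End LipschitzOff.

(* Expanding along the first row, det = cofactor_00 * x_00 + rest, where neither
   the cofactor nor the rest involves x_00; where the cofactor vanishes, use
   induction. *)
Lemma lebesgue_null_det m (phi : 'I_m -> 'I_m -> 'I_N) :
  (forall r c r' c', phi r c = phi r' c' -> r = r' /\ c = c') ->
  lebesgue_null [set p : 'cV[R]_N | \det (\matrix_(r, c) p (phi r c) 0) = 0].
Proof.
elim: m phi => [|m IH] phi phi_inj.
  (* The empty determinant is 1, so the zero set is empty. *)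
  apply: lebesgue_null_subset lebesgue_null0 => p /=.
  by rewrite det_mx00 => /eqP; rewrite oner_eq0.
pose V p : 'M[R]_m.+1 := \matrix_(r, c) p (phi r c) 0.
pose i0 := phi ord0 ord0.
pose a p := cofactor (V p) ord0 ord0.
pose b p := \sum_(j < m) V p ord0 (lift ord0 j) * cofactor (V p) ord0 (lift ord0 j).
(* By injectivity of [phi], every other entry is a coordinate different from [i0]. *)
have entryL r c : (r, c) != (ord0, ord0) -> lipschitz_off i0 (fun p => V p r c).
  move=> rc; under eq_fun do rewrite mxE; apply: lipschitz_off_coord.
  by apply: contraNneq rc => /phi_inj[-> ->].
(* Every cofactor along the first row omits that row, and with it the entry at [i0]. *)
have cofactorL c : lipschitz_off i0 (fun p => cofactor (V p) ord0 c).
  apply: lipschitz_offM; first exact: lipschitz_off_cst.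
  apply: lipschitz_off_det => r c'; under eq_fun do rewrite mxE mxE.
  by apply: entryL; rewrite xpair_eqE eq_sym (negPf (neq_lift _ _)).
have aL : lipschitz_off i0 a by exact: cofactorL.
have bL : lipschitz_off i0 b.
  apply: lipschitz_off_sum => j; apply: lipschitz_offM; last exact: cofactorL.
  by apply: entryL; rewrite xpair_eqE andbC eq_sym (negPf (neq_lift _ _)).
have minorN : lebesgue_null [set p : 'cV[R]_N | \det
    (\matrix_(r < m, c < m) p (phi (lift ord0 r) (lift ord0 c)) 0) = 0].
  by apply: IH => r c r' c' /phi_inj[/lift_inj-> /lift_inj->].
apply: lebesgue_null_subset (lebesgue_nullU minorN (lebesgue_null_affine_zero aL bL)).
move=> p /=; rewrite -/(V p) (expand_det_row _ ord0) big_ord_recl => det0.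
have [a0|a_neq0] := eqVneq (a p) 0; [left|right].
  move: a0; rewrite /a /cofactor expr0 mul1r; apply: etrans.
  by congr (\det _); apply/matrixP => r c; rewrite !mxE.
by split=> //; rewrite -det0 mulrC !mxE.
Qed.

End NullSets.

(** * Rank-deficient weights *)

Lemma mxrank_colsub (F : fieldType) m p q (f : 'I_p -> 'I_q) (V : 'M[F]_(m, q)) :
  (\rank (colsub f V) <= \rank V)%N.
Proof.
rewrite -mxrank_tr -[leqRHS]mxrank_tr -[X in (\rank X <= _)%N]trmxK.
rewrite mxrankS//; have -> : (colsub f V)^T^T^T = rowsub f V^T.
  by apply/matrixP => r c; rewrite !mxE.
exact: rowsub_sub.
Qed.

Section WeightSpace.
Context {R : realType} {n : nat} (A : architecture R n).
Let d := width A.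

(** The coordinate at which an entry of the [j]-th weight matrix sits in the stacked vector of
    weights and biases. *)
Definition weight_index (j : 'I_(depth A).*2) (r : 'I_(d j.+1)) (c : 'I_(d j)) :
    'I_(N_W A + N_B A) :=
  lshift (N_B A) (tagnat.Rank (p_ := fun j : 'I_(depth A).*2 => (d j.+1 * d j)%N)
    j (mxvec_index r c)).

Lemma weight_indexE (W : weights A) (b : biases A) j r c :
  col_mx (vecm W) (stk b) (weight_index (j := j) r c) 0 = W j r c.
Proof.
rewrite col_mxEu /vecm.
have := congr1 (fun M : 'cV_(d j.+1 * d j) => M (mxvec_index r c) 0)
  (mxcolK (fun j : 'I_(depth A).*2 => (mxvec (W j))^T) j).
by rewrite [LHS]mxE => ->; rewrite mxE mxvecE.
Qed.

Lemma weight_index_inj j r c r' c' :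
  weight_index (j := j) r c = weight_index r' c' -> r = r' /\ c = c'.
Proof.
move=> /lshift_inj /(congr1 val)/eqP; rewrite tagnat.eq_Rank eqxx /=.
by move=> /eqP/val_inj/enum_rank_inj[-> ->].
Qed.

Lemma weight_space_gt0 : (0 < N_W A + N_B A)%N.
Proof.
rewrite addn_gt0; apply/orP; right.
rewrite /N_B (bigD1 (Ordinal (inner_subproof (Ordinal (depth_gt0 A)))))//=.
by rewrite addn_gt0 width_gt0// double_gt0 depth_gt0.
Qed.

(** The null set is the union over [j] of the zero sets of one maximal minor of [W j], on the first
    [d j.+1] columns. It contains all rank-deficient weights, but possibly also some of full
    rank. *)
Lemma lebesgue_null_not_full_rank : non_augmented A ->
  exists2 Z : set 'cV[R]_(N_W A + N_B A), lebesgue_null Z &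
    forall (W : weights A) (b : biases A),
      ~ Z (col_mx (vecm W) (stk b)) -> full_rank W.
Proof.
move=> A_nonaug.
pose wid (j : 'I_(depth A).*2) := widen_ord (A_nonaug j (ltn_ord j)).
pose minor (j : 'I_(depth A).*2) (p : 'cV[R]_(N_W A + N_B A)) : 'M[R]_(d j.+1) :=
  \matrix_(r, c) p (weight_index (j := j) r (wid j c)) 0.
exists (\bigcup_j [set p | \det (minor j p) = 0]).
  apply: (lebesgue_null_bigcup weight_space_gt0) => j.
  apply: (lebesgue_null_det weight_space_gt0) => r c r' c'.
  move=> /weight_index_inj[-> /(congr1 val) cc']; split=> //.
  exact: val_inj.
move=> W b notZ j; have d_le : (d j.+1 <= d j)%N by exact: (A_nonaug j (ltn_ord j)).
rewrite (minn_idPl d_le); apply/eqP; rewrite eqn_leq rank_leq_row /=.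
have minorE : minor j (col_mx (vecm W) (stk b)) = colsub (wid j) (W j).
  by apply/matrixP => r c; rewrite mxE weight_indexE mxE.
(* Off the null set the chosen square submatrix is invertible, and its rank bounds that of [W j]
   from below. *)
rewrite -[leqLHS](@mxrank_unit R _ (colsub (wid j) (W j))).
  exact: mxrank_colsub.
rewrite unitmxE unitfE -minorE; apply/eqP => det0.
by apply: notZ; exists j.
Qed.

End WeightSpace.

Theorem theorem3p16 (R : realType) (n k : nat) (X : set 'cV[R]_n) :
  (1 <= k)%N -> open X ->
  [/\ forall (A : architecture R n) (W : weights A) (b : biases A),
        admissible A k -> non_augmented A -> full_rank W ->
        forall x : 'cV[R]_n, X x -> gradient (mlp W b) x <> 0,
      Xi_N_Wstar k X `<=` C1_class k X &
      forall A : architecture R n, admissible A k -> non_augmented A ->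
        exists2 Z : set 'cV[R]_(N_W A + N_B A), lebesgue_null Z &
          forall (W : weights A) (b : biases A),
            ~ Z (col_mx (vecm W) (stk b)) ->
            [/\ Xi_N k X (mlp W b),
                C1_class k X (mlp W b) &
                (2 <= k)%N -> morse X (mlp W b)]].
Proof.
move=> k_gt0 oX; split.
- move=> A W b A_adm A_nonaug W_full x _.
  exact: (gradient_mlp_neq0 A_adm).
- move=> Phi [A [W [b [A_adm A_nonaug W_full PhiE]]]]; split.
    apply: eq_class_C oX _ (class_C_mlp A_adm W b oX) => x Xx.
    by rewrite PhiE.
  move=> x Xx grad0;
  apply: (gradient_mlp_neq0 A_adm k_gt0 A_nonaug W_full (b := b) (x := x)).
  (* [Phi] agrees with the network on [X] only; since [X] is open, the gradients agree at [x]
     too. *)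
  rewrite -[RHS]grad0; apply/matrixP => i j; rewrite !mxE.
  by apply/esym/near_eq_derive; exact: near_eq_open oX PhiE Xx.
- move=> A A_adm A_nonaug.
  have [Z Z_null ZP] := lebesgue_null_not_full_rank A_nonaug.
  exists Z => // W b /ZP W_full.
  have mlpC := class_C_mlp A_adm W b oX.
  have noncrit x : ~ critical_point (mlp W b) x.
    exact: (gradient_mlp_neq0 A_adm).
  split=> [||k_ge2]; first by exists A, W, b.
    by split=> // x _; exact: noncrit.
  (* Without critical points the Hessian condition holds vacuously. *)
  by split=> [|x _ /noncrit//]; exact: class_C_leq k_ge2 mlpC.
Qed.
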